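(* Let $0<p<1$, let $K\subseteq\mathbb{R}$ be a $p$-convex set, and let $F=(f_1,\ldots,f_m):K\to\mathbb{R}^m_+$ be an $\mathbb{R}^m_+$-$p$-convex function. Then the set $E_W$ of weakly efficient points of $F$ on $K$ is a $p$-convex set.
   Context: For $0<p\le 1$, a set $K\subseteq\mathbb{R}^n$ is called $p$-convex if $\lambda x+\mu y\in K$ for every $x,y\in K$ and all $\lambda,\mu\ge 0$ with $\lambda^p+\mu^p=1$. $\mathbb{R}^m_+$ is the set of vectors in $\mathbb{R}^m$ with nonnegative coordinates ($m\ge 1$). For a $p$-convex set $K$, a mapping $F:K\to\mathbb{R}^m$ is $\mathbb{R}^m_+$-$p$-convex if $\lambda F(x)+\mu F(y)\in F(\lambda x+\mu y)+\mathbb{R}^m_+$ for all $x,y\in K$ and all $\lambda,\mu\ge 0$ with $\lambda^p+\mu^p=1$. A point $\bar x\in K$ is a weakly efficient point of $F$ on $K$ if $F(x)-F(\bar x)\in\mathbb{R}^m\setminus(-\mathrm{int}\,\mathbb{R}^m_+)$ for all $x\in K$, i.e. there is no $x\in K$ with $f_i(x)<f_i(\bar x)$ for all $i$. $E_W=E_W(K)$ denotes the set of weakly efficient points of $F$ on $K$. *)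

(* Defs.v *)
From HB Require Import structures.
From mathcomp Require Import all_boot all_order all_algebra.
From mathcomp Require Import all_classical all_reals all_analysis.

Set Implicit Arguments.
Unset Strict Implicit.
Unset Printing Implicit Defensive.

Import Order.TTheory GRing.Theory Num.Theory.
Import numFieldNormedType.Exports.

Local Open Scope classical_set_scope.
Local Open Scope ring_scope.

(* [powR] satisfies [0 `^ p = 0] for [p != 0], as required when [l] or [u]
   vanishes. *)
Definition p_convex_set (R : realType) (V : lmodType R) (p : R) (K : set V) :=
  forall (x y : V) (l u : R), K x -> K y -> 0 <= l -> 0 <= u ->
    l `^ p + u `^ p = 1 -> K (l *: x + u *: y).

Definition nonneg_orthant (R : realType) (m : nat) : set 'rV[R]_m :=
  [set v | forall i, 0 <= v 0 i].
Arguments nonneg_orthant : clear implicits.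

(* A map [K -> R^m] is represented by a total function on the ambient space, of
   which only the values on [K] matter; for [K] [p]-convex the point
   [l *: x + u *: y] is again in [K]. *)
Definition p_convex_map (R : realType) (V : lmodType R) (m : nat) (p : R)
    (K : set V) (F : V -> 'rV[R]_m) :=
  forall (x y : V) (l u : R), K x -> K y -> 0 <= l -> 0 <= u ->
    l `^ p + u `^ p = 1 ->
    [set F (l *: x + u *: y) + c | c in nonneg_orthant R m]
      (l *: F x + u *: F y).

Definition weakly_efficient (R : realType) (V : lmodType R) (m : nat)
    (K : set V) (F : V -> 'rV[R]_m) : set V :=
  [set xbar | K xbar /\
    forall x, K x -> (~` (-%R @` (nonneg_orthant R m)°)) (F x - F xbar)].

(* Main.v *)
(** Since [F >= 0] and [F (c x) <= c F x] for [c = 2 ^ (1 - 1/p) < 1], a point of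
    [K] is weakly efficient iff some coordinate of [F] vanishes there.  The zero
    set in [K] of each coordinate is itself [p]-convex, hence closed under
    scaling by [t] in [(0, 1]].  On the line, if [l x + u y] is nonzero then
    [l + u <= 1] makes it such a multiple of [x] or of [y], and so it inherits
    a vanishing coordinate; if it is zero, then [F 0 = 0]. *)
Require Import Defs.
From mathcomp Require Import all_boot all_order all_algebra.
From mathcomp Require Import all_classical all_reals all_analysis.
From mathcomp Require Import lra.

Set Implicit Arguments.
Unset Strict Implicit.
Unset Printing Implicit Defensive.

Import Order.TTheory GRing.Theory Num.Theory.
Import numFieldNormedType.Exports.

Local Open Scope classical_set_scope.
Local Open Scope ring_scope.

Lemma powRVK (R : realType) (p a : R) : p != 0 -> 0 <= a ->
  (a `^ p^-1) `^ p = a.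
Proof. by move=> p0 a0; rewrite -powRrM mulVf// powRr1. Qed.

(** These are the equal weights whose [p]-th powers sum to 1. Taking logarithms, each is below
    [2^-1] because [p^-1 > 1] and [ln 2^-1 < 0]. *)
Lemma half_powRV_sum_lt1 (R : realType) (p : R) : 0 < p -> p < 1 ->
  2^-1 `^ p^-1 + 2^-1 `^ p^-1 < 1 :> R.
Proof.
move=> p0 p1; suff : 2^-1 `^ p^-1 < 2^-1 :> R by lra.
have h0 : 0 < 2^-1 :> R by lra.
rewrite /powR gt_eqF// -ltr_ln ?posrE ?expR_gt0// expRK.
have ln_lt0 : ln 2^-1 < 0 :> R by apply: ln_lt0; lra.
have : 1 < p^-1 by rewrite invf_gt1.
by nra.
Qed.

Lemma p_weights_sum_le1 (R : realType) (p l u : R) : 0 < p -> p <= 1 ->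
  0 <= l -> 0 <= u -> l `^ p + u `^ p = 1 -> l + u <= 1.
Proof.
move=> p0 p1.
have le_powR (a b : R) : 0 <= a -> a `^ p + b `^ p = 1 -> a <= a `^ p.
  move=> a0 ab1; move: a0; rewrite le_eqVlt => /predU1P[<-|a0].
    exact: powR_ge0.
  apply: ger1_powR p1; rewrite a0 leNgt; apply/negP => a1.
  have := @gt0_ltr_powR _ _ p0 1 a.
  rewrite !nnegrE ler01 ltW// => /(_ isT isT a1).
  by rewrite powR1; have := powR_ge0 b p; lra.
move=> l0 u0 lu; have := le_powR _ _ l0 lu.
by rewrite addrC in lu; have := le_powR _ _ u0 lu; lra.
Qed.

Lemma powR_continuous (R : realType) (q s : R) : 0 < s ->
  {for s, continuous (fun x : R => x `^ q)}.
Proof.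
move=> s0; apply/differentiable_continuous/derivable1_diffP.
by apply: derivable_powR; rewrite in_itv/= s0.
Qed.

(** Intermediate value theorem on [[0, 2^-1]]. For [q = p^-1] the two summands are weights whose
    [p]-th powers are [s] and [1 - s]. *)
Lemma powR_sum_surjective (R : realType) (q t : R) : 0 < q ->
  2^-1 `^ q + 2^-1 `^ q <= t -> t <= 1 ->
  exists2 s : R, 0 <= s <= 1 & s `^ q + (1 - s) `^ q = t.
Proof.
move=> q0 ct t1; pose g (s : R) := s `^ q + (1 - s) `^ q.
have cpl (s : R) : s < 1 -> {for s, continuous (fun x : R => (1 - x) `^ q)}.
  move=> s1; have sub : {for s, continuous (fun x : R => 1 - x)}.
    by apply: cvgB; [exact: cvg_cst | exact: cvg_id].
  have pow : {for 1 - s, continuous (fun x : R => x `^ q)}.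
    by apply: powR_continuous; rewrite subr_gt0.
  exact: (@continuous_comp R R R _ _ s sub pow).
have cg (s : R) : 0 < s < 1 -> {for s, continuous g}.
  move=> /andP[s0 s1]; apply: cvgD; [exact: powR_continuous | exact: cpl].
have g0 : g 0 = 1 by rewrite /g powR0 ?gt_eqF// subr0 powR1 add0r.
have gh : g 2^-1 = 2^-1 `^ q + 2^-1 `^ q.
  by rewrite /g; congr (_ + _ `^ _); lra.
have h0 : 0 < 2^-1 :> R by lra.
have gc : {within `[0, 2^-1], continuous g}.
  apply/(continuous_within_itvP _ h0); split.
  - by move=> s; rewrite in_itv/= => /andP[s0 s1]; apply: cg; lra.
  - apply: cvgD; first by rewrite powR0 ?gt_eqF//; exact: powR_cvg0.
    by apply: cvg_at_right_filter; apply: cpl; lra.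
  - by apply: cvg_at_left_filter; apply: cg; lra.
have [|s] := @IVT _ g 0 2^-1 t (ltW h0) gc.
  by rewrite g0 gh ge_min le_max t1 ct orbT.
by rewrite in_itv/= => s01 <-; exists s => //; lra.
Qed.

(* Equal weights contract by [c = 2 ^ (1 - 1/p)] and, by the intermediate value
   theorem, [l + u] takes every value in [[c, 1]]; iterating reaches every
   [t > 0]. *)
Lemma p_convex_set_scale (R : realType) (V : lmodType R) (p : R) (S : set V)
    (x : V) (t : R) : 0 < p -> p < 1 -> p_convex_set p S -> S x ->
  0 < t -> t <= 1 -> S (t *: x).
Proof.
move=> p0 p1 Sconv Sx.
pose c : R := 2^-1 `^ p^-1 + 2^-1 `^ p^-1.
have c0 : 0 < c by rewrite addr_gt0// powR_gt0.
have c1 : c < 1 by exact: half_powRV_sum_lt1.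
(* Applied to [y] twice, [p]-convexity multiplies [y] by the sum of the weights. *)
have scale y s : S y -> c <= s -> s <= 1 -> S (s *: y).
  move=> Sy cs s1.
  have [|r /andP[r0 r1] <-] := powR_sum_surjective _ cs s1; first by rewrite invr_gt0.
  rewrite scalerDl; apply: Sconv => //; try exact: powR_ge0.
  by rewrite !powRVK ?gt_eqF//; lra.
have iter n s : c ^+ n <= s -> s <= 1 -> S (s *: x).
  elim: n s => [|n IHn] s.
    by rewrite expr0 => s1 s1'; rewrite (_ : s = 1) ?scale1r//; lra.
  (* If [s < c], then [s / c] lies between [c ^+ n] and 1, and one more scaling by [c] gives [s]. *)
  rewrite exprS => cs s1; have [cs'|sc] := leP c s; first exact: scale.
  rewrite (_ : s = c * (s / c)); last by rewrite mulrC divfK// gt_eqF.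
  rewrite -scalerA; apply: scale => //; last exact: ltW.
  by apply: IHn; [rewrite ler_pdivlMr// mulrC | rewrite ler_pdivrMr// mul1r ltW].
move=> t0 t1; suff [n] : exists n, c ^+ n <= t by move=> ?; exact: (iter n).
have /cvgrPdist_le/(_ _ t0)[n _ /(_ n (leqnn n))] : (GRing.exp c : R ^nat) @ \oo --> 0.
  by apply: cvg_expr; rewrite ger0_norm// ltW.
by rewrite /= sub0r normrN ger0_norm ?exprn_ge0 ?(ltW c0)// => ct; exists n.
Qed.

Lemma interior_nonneg_orthantP (R : realType) (m : nat) (v : 'rV[R]_m) :
  (nonneg_orthant R m)° v <-> forall i, 0 < v 0 i.
Proof.
split=> [/nbhs_ballP[e /= e0 sub] i|v0].
  have e2 : 0 < e / 2 by rewrite divr_gt0.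
  (* Lowering every coordinate by [e / 2] stays in the ball, hence in the orthant. *)
  have /sub/(_ i) : ball v e (v - const_mx (e / 2)).
    split=> // k j; rewrite /ball/= !mxE opprB addrCA subrr addr0.
    by rewrite gtr0_norm//; lra.
  by rewrite !mxE; lra.
rewrite /interior; near=> w; rewrite /nonneg_orthant/=.
near: w; apply: filter_forall => i.
have := @coord_continuous R 1 m 0 i v.
by move=> /cvgr_ge; exact.
Unshelve. all: by end_near. Qed.

Section nonneg_p_convex_map.
Variables (R : realType) (V : lmodType R) (m : nat) (p : R) (K : set V).
Variable F : V -> 'rV[R]_m.
Hypotheses (p_gt0 : 0 < p) (p_lt1 : p < 1).
Hypotheses (Kconv : p_convex_set p K) (Fconv : p_convex_map p K F).
Hypothesis F_ge0 : forall x, K x -> nonneg_orthant R m (F x).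

Lemma p_convex_map_coord (x y : V) (l u : R) i : K x -> K y ->
  0 <= l -> 0 <= u -> l `^ p + u `^ p = 1 ->
  F (l *: x + u *: y) 0 i <= l * F x 0 i + u * F y 0 i.
Proof.
move=> Kx Ky l0 u0 lu; have [d d0 /rowP/(_ i)] := Fconv Kx Ky l0 u0 lu.
by rewrite !mxE => <-; rewrite lerDl; exact: d0.
Qed.

Lemma p_convex_zero_set i : p_convex_set p [set x | K x /\ F x 0 i = 0].
Proof.
move=> x y l u [Kx Fx] [Ky Fy] l0 u0 lu; have Kz := Kconv Kx Ky l0 u0 lu.
split=> //; apply/eqP; rewrite eq_le F_ge0// andbT.
by have := p_convex_map_coord i Kx Ky l0 u0 lu; rewrite Fx Fy !mulr0 addr0.
Qed.

Lemma weakly_efficientE :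
  weakly_efficient K F = [set x | K x /\ exists i, F x 0 i = 0].
Proof.
apply/seteqP; split=> x [Kx]; last first.
  move=> [i Fxi]; split=> // y Ky [d /interior_nonneg_orthantP/(_ i) d0].
  by move=> /rowP/(_ i); rewrite !mxE Fxi; have := F_ge0 Ky i; lra.
move=> xeff; split=> //; apply: contrapT => /forallNP Fx_neq0.
pose a : R := 2^-1 `^ p^-1.
have a0 : 0 <= a by exact: powR_ge0.
have aa : a `^ p + a `^ p = 1 by rewrite powRVK ?gt_eqF//; lra.
have a1 : a + a < 1 by exact: half_powRV_sum_lt1.
(* The competitor [a *: x + a *: x] has coordinates at most [a + a < 1] times the positive ones of
   [F x]. *)
apply: (xeff _ (Kconv Kx Kx a0 a0 aa)).
exists (F x - F (a *: x + a *: x)); last by rewrite opprB.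
apply/interior_nonneg_orthantP => i; rewrite !mxE.
have Fxi : 0 < F x 0 i by rewrite lt_def F_ge0// andbT; exact/eqP/Fx_neq0.
by have := p_convex_map_coord i Kx Kx a0 a0 aa; nra.
Qed.

(** Equal weights at 0 bound the nonnegative value [F 0 0 i] by [a + a < 1] times itself. *)
Lemma p_convex_map0 i : K 0 -> F 0 0 i = 0.
Proof.
move=> K0; pose a : R := 2^-1 `^ p^-1.
have a0 : 0 <= a by exact: powR_ge0.
have aa : a `^ p + a `^ p = 1 by rewrite powRVK ?gt_eqF//; lra.
have a1 : a + a < 1 by exact: half_powRV_sum_lt1.
have := p_convex_map_coord i K0 K0 a0 a0 aa.
by rewrite scaler0 addr0; have := F_ge0 K0 i; nra.
Qed.

End nonneg_p_convex_map.

(** A positive combination is at most [l + u <= 1] times the larger of [x], [y], which is thus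
    positive and at least the combination; a negative one is compared with the smaller. The quotient
    is [t]. *)
Lemma sub_convex_comb_scale (R : realFieldType) (x y l u : R) :
  0 <= l -> 0 <= u -> l + u <= 1 -> l * x + u * y != 0 ->
  exists t, [/\ 0 < t, t <= 1 & l * x + u * y = t * x \/ l * x + u * y = t * y].
Proof.
move=> l0 u0 lu; set z := l * x + u * y => z0.
have scale w : 0 < z / w <= 1 -> w != 0 -> (w = x \/ w = y) ->
    exists t, [/\ 0 < t, t <= 1 & z = t * x \/ z = t * y].
  move=> /andP[t0 t1] w0 wxy; exists (z / w); split=> //.
  by case: wxy => <-; rewrite divfK//; [left | right].
have pos w : 0 < z -> x <= w -> y <= w -> (w = x \/ w = y) ->
    exists t, [/\ 0 < t, t <= 1 & z = t * x \/ z = t * y].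
  move=> zp xw yw; have zlu : z <= (l + u) * w.
    by rewrite mulrDl lerD// ler_wpM2l.
  have wp : 0 < w by nra.
  apply: scale; rewrite ?gt_eqF// divr_gt0//= ler_pdivrMr// mul1r.
  by nra.
have neg w : z < 0 -> w <= x -> w <= y -> (w = x \/ w = y) ->
    exists t, [/\ 0 < t, t <= 1 & z = t * x \/ z = t * y].
  move=> zn wx wy; have zlu : (l + u) * w <= z.
    by rewrite mulrDl lerD// ler_wpM2l.
  have wn : w < 0 by nra.
  apply: scale; rewrite ?lt_eqF// nmulr_rgt0 ?invr_lt0//= ler_ndivrMr// mul1r.
  by nra.
have [xy|/ltW yx] := leP x y; case: (ltgtP z 0) z0 => // zs _.
- by apply: (neg x); auto.
- by apply: (pos y); auto.
- by apply: (neg y); auto.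
- by apply: (pos x); auto.
Qed.

Theorem corollary6p7 (R : realType) (m : nat) (p : R) (K : set R^o)
    (F : R^o -> 'rV[R]_m) (hm : (0 < m)%N) (p_gt0 : 0 < p) (p_lt1 : p < 1)
    (Kconv : p_convex_set p K)
    (F_ge0 : forall x, K x -> nonneg_orthant R m (F x))
    (Fconv : p_convex_map p K F) :
  p_convex_set p (weakly_efficient K F).
Proof.
rewrite (weakly_efficientE p_gt0)//.
move=> x y l u [Kx [i Fxi]] [Ky [j Fyj]] l0 u0 lu.
have Kz := Kconv _ _ _ _ Kx Ky l0 u0 lu.
split=> //; have [z0|z_neq0] := eqVneq (l *: x + u *: y) 0.
  (* Every coordinate vanishes at 0, so any index will do; [0 < m] provides one. *)
  by rewrite z0 in Kz *; exists (Ordinal hm); exact: (p_convex_map0 p_gt0 p_lt1 Fconv).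
have lu1 := p_weights_sum_le1 p_gt0 (ltW p_lt1) l0 u0 lu.
have [t [t0 t1 zt]] := sub_convex_comb_scale l0 u0 lu1 z_neq0.
have zero_set_scale w k (Kw : K w) (Fw : F w 0 k = 0) : F (t *: w) 0 k = 0.
  have := p_convex_zero_set (i := k) Kconv Fconv F_ge0.
  by move=> /(p_convex_set_scale p_gt0 p_lt1)/(_ (conj Kw Fw) t0 t1) [].
by case: zt => ->; [exists i | exists j]; exact: zero_set_scale.
Qed.
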